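(* Let $\mathcal H$ be finite-dimensional, let $\mathcal T$ be a convex set of states on $\mathcal H$, and let $\mathcal A$ be a convex set of effects on $\mathcal H$ containing $I$ and closed under $E\mapsto I-E$. Then the subtheory $(\mathcal T,\mathcal A)$ is measurement and preparation non-contextual if and only if $(\mathcal T,\mathcal A)$ is $1\to n$-pseudo-broadcastable for every $n\in\mathbb N$.
   Context: An effect is an operator $E$ with $0\le E\le I$. The subtheory $(\mathcal T,\mathcal A)$ is measurement and preparation non-contextual if there exist operators $\{\tilde G_\lambda\}_\lambda$ and $\{\tilde\sigma_\lambda\}_\lambda$ on $\mathcal H$ (finite index set) such that $\mathrm{tr}[\rho E]=\sum_\lambda\mathrm{tr}[\rho\tilde G_\lambda]\mathrm{tr}[\tilde\sigma_\lambda E]$ for all $\rho\in\mathcal T$, $E\in\mathcal A$, where $\mathrm{tr}[\rho\tilde G_\lambda]\ge0$ and $\sum_\lambda\mathrm{tr}[\rho\tilde G_\lambda]=1$ for all $\rho\in\mathcal T$, and $\mathrm{tr}[\tilde\sigma_\lambda E]\ge0$, $\mathrm{tr}[\tilde\sigma_\lambda]=1$ for all $\lambda$ and all $E\in\mathcal A$ (the operators need not be positive). $(\mathcal T,\mathcal A)$ is $1\to n$-pseudo-broadcastable if there is a trace-preserving linear map $\Xi:\mathcal L(\mathcal H)\to\mathcal L(\mathcal H^{\otimes n})$ (not necessarily positive) such that $\mathrm{tr}[A\,\mathrm{tr}_{i^c}\Xi(\rho)]=\mathrm{tr}[A\rho]$ for all $i\in\{1,\dots,n\}$, $\rho\in\mathcal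 T$, $A\in\mathcal A$, and $\mathrm{tr}[\Xi(\rho)\,(A_1\otimes\cdots\otimes A_n)]\ge0$ for all $\rho\in\mathcal T$ and $A_1,\dots,A_n\in\mathcal A$; here $\mathrm{tr}_{i^c}$ is the partial trace over all tensor factors except the $i$-th. *)

(* Defs.v *)
From HB Require Import structures.
From mathcomp Require Import all_boot all_order all_algebra.
From mathcomp Require Import complex.
From mathcomp Require Import reals.
Set Implicit Arguments. Unset Strict Implicit. Unset Printing Implicit Defensive.
Import Order.TTheory GRing.Theory Num.Theory.
Local Open Scope ring_scope.

(* Hilbert space H = C^d, C = R[i]; operators on H are 'M[R[i]]_d. *)

Definition adjmx (R : realType) m n (A : 'M[R[i]]_(m, n)) : 'M[R[i]]_(n, m) :=
  \matrix_(i, j) (A j i)^*.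

Definition psd (R : realType) d (A : 'M[R[i]]_d) : Prop :=
  adjmx A = A /\ forall v : 'cV[R[i]]_d, 0 <= (adjmx v *m A *m v) ord0 ord0.

Definition is_state (R : realType) d (rho : 'M[R[i]]_d) : Prop :=
  psd rho /\ \tr rho = 1.

Definition is_effect (R : realType) d (E : 'M[R[i]]_d) : Prop :=
  psd E /\ psd (1%:M - E).

Definition convex_set (R : realType) d (S : 'M[R[i]]_d -> Prop) : Prop :=
  forall (x y : 'M[R[i]]_d) (t : R[i]), 0 <= t -> t <= 1 -> S x -> S y ->
    S (t *: x + (1 - t) *: y).

Definition MP_noncontextual (R : realType) d (T A : 'M[R[i]]_d -> Prop) : Prop :=
  exists (k : nat) (G sigma : 'I_k -> 'M[R[i]]_d),
    (forall rho E, T rho -> A E ->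
       \tr (rho *m E) = \sum_(l < k) \tr (rho *m G l) * \tr (sigma l *m E)) /\
    (forall rho, T rho ->
       (forall l, 0 <= \tr (rho *m G l)) /\ \sum_(l < k) \tr (rho *m G l) = 1) /\
    (forall l, \tr (sigma l) = 1 /\ forall E, A E -> 0 <= \tr (sigma l *m E)).

(* H^{(x) n}: basis indexed by n-tuples of basis indices of H;
   an operator on H^{(x) n} is given by its matrix entries X s t. *)
Definition tidx (d n : nat) := {ffun 'I_n -> 'I_d}.
Definition opn (R : realType) (d n : nat) := tidx d n -> tidx d n -> R[i].

Definition trn (R : realType) d n (X : opn R d n) : R[i] := \sum_(s : tidx d n) X s s.

(* partial trace over all tensor factors except the i-th *)
Definition ptr_keep (R : realType) d n (i : 'I_n) (X : opn R d n) : 'M[R[i]]_d :=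
  \matrix_(a, b) \sum_(s : tidx d n | s i == a)
     \sum_(t : tidx d n | (t i == b) && [forall j, (j != i) ==> (t j == s j)]) X s t.

(* tr[X (A_1 (x) ... (x) A_n)] *)
Definition tr_tens (R : realType) d n (X : opn R d n) (As : 'I_n -> 'M[R[i]]_d) : R[i] :=
  \sum_(s : tidx d n) \sum_(t : tidx d n) X s t * \prod_(k < n) As k (t k) (s k).

Definition linear_map (R : realType) d n (Xi : 'M[R[i]]_d -> opn R d n) : Prop :=
  forall (a : R[i]) (X Y : 'M[R[i]]_d) s t,
    Xi (a *: X + Y) s t = a * Xi X s t + Xi Y s t.

Definition pseudo_broadcastable (R : realType) d (T A : 'M[R[i]]_d -> Prop) (n : nat) : Prop :=
  exists Xi : 'M[R[i]]_d -> opn R d n,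
    linear_map Xi /\
    (forall X, trn (Xi X) = \tr X) /\
    (forall (i : 'I_n) rho E, T rho -> A E -> \tr (E *m ptr_keep i (Xi rho)) = \tr (E *m rho)) /\
    (forall rho (As : 'I_n -> 'M[R[i]]_d), T rho -> (forall k, A (As k)) ->
       0 <= tr_tens (Xi rho) As).

(* Main.v *)
Require Import Defs.
From HB Require Import structures.
From mathcomp Require Import all_boot all_order all_algebra all_fingroup.
From mathcomp Require Import complex.
From mathcomp Require Import boolp classical_sets reals topology normedtype.
From mathcomp Require Import ring lra.
Set Implicit Arguments.
Unset Strict Implicit.
Unset Printing Implicit Defensive.
Import Order.TTheory GRing.Theory Num.Theory numFieldNormedType.Exports.
Local Open Scope ring_scope.

(** If tr[rho E] = sum_l tr[rho G_l] tr[sigma_l E], then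
    X |-> sum_l tr[X G_l] sigma_l^{(x)n} broadcasts, once the G_l have been
    corrected so as to sum to the identity.

    The converse is a de Finetti argument. Fix finite families r_i in T and E_j
    in A spanning T and A. Take a symmetrised broadcasting map on |J| n + n
    systems and measure each E_j on n systems of its own. The outcome string x
    has a probability p_rho(x) that is affine in rho, and its frequencies
    phi_x(j) satisfy sum_x p_rho(x) phi_x(j) = tr[rho E_j]. The functional phi_x
    need not be nonnegative on A, but the conditional state of the last n systems
    is, and by exchangeability both estimate the same thing: the mean difference
    of their values on E_j is O(1/sqrt n). Replacing phi_x by a point q_x close to
    it in the convex body of normalised functionals nonnegative on A (a choice
    that does not depend on rho) gives an approximate decomposition of
    tr[r_i E_j]. By Caratheodory's theorem |I| |J| terms suffice, so the limit
    n -> oo exists by compactness. *)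

(** * Closedness of the set of finite decompositions *)

Lemma nontrivial_kernel_row (F : fieldType) (m n : nat) (V : 'M[F]_(m, n)) :
  (n < m)%N -> exists2 l : 'rV_m, l != 0 & l *m V = 0.
Proof.
move=> nm; have : kermx V != 0.
  rewrite kermx_eq0 /row_free neq_ltn (leq_ltn_trans (rank_leq_col V))//.
by case/rowV0Pn => l /sub_kermxP lV l0; exists l.
Qed.

(* Coefficients of a linear dependency, divided by the one of largest absolute
   value and subtracted from 1, are nonnegative and kill that entry. *)
Lemma caratheodory_step (R : realType) (D : finType) (k : nat)
    (v : 'I_k.+1 -> D -> R) :
  (#|D| <= k)%N ->
  exists (x : 'I_k.+1) (c : 'I_k.+1 -> R), [/\ forall y, 0 <= c y, c x = 0 &
    forall d, \sum_y c y * v y d = \sum_y v y d].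
Proof.
move=> Dk; pose V := \matrix_(y, j) v y (enum_val j) : 'M_(k.+1, #|D|).
have [l l0 lV] := @nontrivial_kernel_row _ _ _ V Dk.
pose x := [arg max_(y > ord0) `|l 0 y|]%O.
have xmax y : `|l 0 y| <= `|l 0 x|.
  by rewrite /x; case: Order.TotalTheory.arg_maxP => // z _; apply.
have lx : l 0 x != 0.
  apply: contraNneq l0 => lx0; apply/eqP/rowP => y.
  by have := xmax y; rewrite lx0 normr0 normr_le0 mxE => /eqP.
exists x, (fun y => 1 - l 0 y / l 0 x); split => [y||d].
- rewrite subr_ge0 (le_trans (ler_norm _))// normrM normfV.
  by rewrite ler_pdivrMr ?normr_gt0// mul1r.
- by rewrite divff// subrr.
- under eq_bigr do rewrite mulrBl mul1r mulrAC.
  rewrite sumrB -mulr_suml; move/rowP: lV => /(_ (enum_rank d)).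
  rewrite !mxE; under eq_bigr do rewrite mxE enum_rankK.
  by move=> ->; rewrite mul0r subr0.
Qed.

(** Caratheodory for the products [g x i * q x j], seen as vectors indexed by [I * J]. The
    coefficients are absorbed into [g], which ranges over a cone; [q] is only selected, never
    rescaled, so its normalisation survives. *)
Lemma caratheodory_products (R : realType) (I J : finType) (k : nat)
    (Kg : (I -> R) -> Prop) (Kq : (J -> R) -> Prop)
    (g : 'I_k -> I -> R) (q : 'I_k -> J -> R) :
  (forall c h, 0 <= c -> Kg h -> Kg (fun i => c * h i)) ->
  (0 < k)%N -> (forall x, Kg (g x)) -> (forall x, Kq (q x)) ->
  exists (g' : 'I_#|{: I * J}| -> I -> R) (q' : 'I_#|{: I * J}| -> J -> R),
    [/\ forall l, Kg (g' l), forall l, Kq (q' l) &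
     forall i j, \sum_l g' l i * q' l j = \sum_x g x i * q x j].
Proof.
move=> Kcone; elim: k => [//|k IH] in g q *; move=> _ Hg Hq.
have [kle|klt] := leqP k.+1 #|{: I * J}|.
  (* Pad with zero responses up to |I||J| terms; past the end [inord] falls back on an existing
     index, so [q] stays in [Kq]. *)
  exists (fun l i => (l < k.+1)%N%:R * g (inord l) i), (fun l => q (inord l)).
  split=> [l|l|i j]; [exact: Kcone|exact: Hq|].
  rewrite [RHS](eq_bigr (fun x : 'I_k.+1 => g (inord x) i * q (inord x) j)); last first.
    by move=> x _; rewrite inord_val.
  rewrite (big_ord_widen _ (fun l => g (inord l) i * q (inord l) j) kle).
  rewrite [RHS]big_mkcond /=; apply: eq_bigr => l _.
  by case: ifP => _; rewrite ?mul1r ?mul0r.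
have [x [c [c0 cx csum]]] :=
  @caratheodory_step _ _ _ (fun y (d : {: I * J}) => g y d.1 * q y d.2) klt.
(* The induction hypothesis asks for a positive number of terms; a single term is removed by hand,
   its coefficient being zero. *)
case: k => [|k] in IH g q Hg Hq klt x c c0 cx csum *.
  exists (fun l i => 0 * g ord0 i), (fun=> q ord0).
  split=> [l|l|i j]; [exact: Kcone|exact: Hq|].
  rewrite -(csum (i, j)) !big_ord1 /=.
  move: cx; rewrite (ord1 x) => ->; rewrite [RHS]mul0r big1// => l _.
  by rewrite mul0r mul0r.
have [//|||g' [q' [Hg' Hq' E]]] := IH (fun y i => c (lift x y) * g (lift x y) i)
  (fun y => q (lift x y)).
- by move=> y; exact: Kcone.
- by move=> y; exact: Hq.
exists g', q'; split=> // i j; rewrite E -(csum (i, j)) (bigD1_ord x)//= cx mul0r add0r.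
by apply: eq_bigr => y _; rewrite mulrA.
Qed.

(** Supplies the point q_x near phi_x; a slack [e] stands in for attainment of the infimum. *)
Lemma near_minimum (R : realType) (S : Type) (K : S -> Prop) (f : S -> R) (e : R) :
  (exists s, K s) -> (forall s, 0 <= f s) -> 0 < e ->
  exists2 s, K s & forall s', K s' -> f s <= f s' + e.
Proof.
move=> [s0 Ks0] f0 e0.
pose E : set R := fun y => exists2 s, K s & f s = y.
have lbE : has_lbound E by exists 0 => _ [s _ <-].
have infE : has_inf E by split=> //; exists (f s0), s0.
have [_ [s Ks <-] fs] := inf_adherent e0 infE.
exists s => // s' Ks'; rewrite (le_trans (ltW fs))// lerD2r.
by apply: ge_inf => //; exists s'.
Qed.

(** A weak law of large numbers: orthogonality kills the cross terms, so the mean m has second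
    moment at most 1/n <= e^2, and |m| <= e/2 + m^2/(2e) turns this into a first-moment bound. *)
Lemma paired_mean_deviation (R : realType) (W : finType) (P : W -> R) (n : nat)
    (x : 'I_n -> W -> R) (e : R) :
  (forall w, 0 <= P w) -> \sum_w P w = 1 ->
  (forall i w, `|x i w| <= 1) ->
  (forall i i', i != i' -> \sum_w P w * (x i w * x i' w) = 0) ->
  0 < e -> 1 <= n%:R * e ^+ 2 ->
  \sum_w P w * `|n%:R^-1 * \sum_i x i w| <= e.
Proof.
move=> P0 P1 x1 xx e0 ne.
have n0 : 0 < n%:R :> R.
  by case: n {x x1 xx} ne => [|n]; rewrite ?ltr0Sn// mul0r ler10.
pose m w := n%:R^-1 * \sum_i x i w.
have second : \sum_w P w * m w ^+ 2 <= n%:R^-1.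
  have E w : P w * m w ^+ 2 =
     n%:R^-2 * \sum_i \sum_i' P w * (x i w * x i' w).
    rewrite exprMn exprVn mulrCA [(\sum_i _) ^+ 2]expr2 mulr_suml; congr (_ * _).
    rewrite mulr_sumr; apply: eq_bigr => i _; rewrite !mulr_sumr.
    by apply: eq_bigr.
  under eq_bigr do rewrite E.
  rewrite -mulr_sumr exchange_big /= expr2 invfM -mulrA ler_piMr ?invr_ge0 ?(ltW n0)//.
  rewrite ler_pdivrMl// mulr1 -[n in leRHS]card_ord -sumr_const.
  apply: ler_sum => i _; rewrite exchange_big (bigD1 i)//= [X in _ + X]big1 ?addr0; last first.
    by move=> i' ii'; rewrite xx// eq_sym.
  rewrite -P1; apply: ler_sum => w _; rewrite ler_piMr// -expr2.
  by rewrite -real_normK ?num_real// expr_le1.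
have e2 : 0 < 2 * e by rewrite mulr_gt0.
have step w : P w * `|m w| <= P w * (e / 2) + (2 * e)^-1 * (P w * m w ^+ 2).
  rewrite [X in _ + X]mulrCA -mulrDr ler_wpM2l//.
  (* AM-GM *)
  rewrite -[m w ^+ 2]real_normK ?num_real//; move: `|m w| => a.
  rewrite -(ler_pM2l e2) mulrDr mulVKf ?gt_eqF//.
  have -> : 2 * e * (e / 2) = e ^+ 2 by field.
  by have := sqr_ge0 (a - e); nra.
rewrite (le_trans (ler_sum _ (fun w _ => step w)))// big_split /= -mulr_suml P1 mul1r.
rewrite -mulr_sumr [leRHS]splitr lerD2l ler_pdivrMl//.
rewrite (le_trans second)// -[n%:R^-1]mul1r ler_pdivrMr//.
by move: ne; rewrite expr2; set N := n%:R; lra.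
Qed.

(** * Compactness of the set of decompositions with boundedly many terms *)

Local Open Scope classical_set_scope.

(** [S] is closed in the cube [0,1]^Z, which is compact by Tychonoff, so [F] maps it onto a closed
    set of reals, and 0 adheres to that set. *)
Lemma ptws_compact_zero (R : realType) (Z : finType)
    (S : set {ptws Z -> R}) (F : {ptws Z -> R} -> R) :
  closed S -> (forall h, S h -> forall z, 0 <= h z <= 1) ->
  continuous F -> (forall h, S h -> 0 <= F h) ->
  (forall e, 0 < e -> exists2 h, S h & F h <= e) ->
  exists2 h, S h & F h = 0.
Proof.
move=> Scl Sbox Fc F0 Finf.
have Sco : compact S.
  apply: (subclosed_compact Scl (@tychonoff Z (fun=> R) (fun=> `[0, 1]%classic) _)).
    by move=> _; exact: segment_compact.
  by move=> h Sh z /=; rewrite in_itv /=; exact: Sbox.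
have Fco : compact (F @` S).
  by apply: continuous_compact => //; exact: continuous_subspaceT.
have /closure_id Fcl := compact_closed (@norm_hausdorff _ R) Fco.
suff : (F @` S) 0 by case=> h Sh Fh0; exists h.
rewrite Fcl => B /= /nbhs_ballP[e /= e0 eB].
have [h Sh Fh] := Finf (e / 2) (divr_gt0 e0 (ltr0Sn _ 1)).
exists (F h); split; first by exists h.
apply: eB; rewrite /ball /= sub0r normrN ger0_norm ?F0//.
by rewrite (le_lt_trans Fh)// ltr_pdivrMr// ltr_pMr// ltr1n.
Qed.

Lemma ptws_eval_continuous (R : realType) (Z : finType) (z : Z) :
  continuous (fun h : {ptws Z -> R} => h z).
Proof. exact: (@proj_continuous Z (fun=> R) z). Qed.

Lemma continuous_bigsum (R : realType) (S : topologicalType) (I : finType)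
    (f : I -> S -> R) :
  (forall i, continuous (f i)) -> continuous (fun h => \sum_i f i h).
Proof.
move=> fc h; apply: (@cvg_big _ _ +%R 0) => [|i _]; last exact: fc.
exact: add_continuous.
Qed.

Lemma closed_ge_continuous (R : realType) (S : topologicalType) (f : S -> R)
  (a : R) : continuous f -> closed [set h | a <= f h].
Proof.
by move=> fc; apply: (closed_comp (D := [set x | a <= x])) => [h _|];
  [exact: fc|exact: closed_ge].
Qed.

Lemma closed_eq_continuous (R : realType) (S : topologicalType) (f : S -> R)
  (a : R) : continuous f -> closed [set h | f h = a].
Proof.
by move=> fc; apply: (closed_comp (D := [set x | x = a])) => [h _|];
  [exact: fc|exact: closed_eq].
Qed.

Lemma closed_le_continuous (R : realType) (S : topologicalType) (f : S -> R)
  (a : R) : continuous f -> closed [set h | f h <= a].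
Proof.
by move=> fc; apply: (closed_comp (D := [set x | x <= a])) => [h _|];
  [exact: fc|exact: closed_le].
Qed.

Lemma continuous_dist (R : realType) (S : topologicalType) (f : S -> R) (a : R) :
  continuous f -> continuous (fun h => `|f h - a|).
Proof.
move=> fc h; apply: (@cvg_norm _ _ _ (nbhs h) _ (fun h => f h - a)).
by apply: (@cvgB _ _ _ (nbhs h) _ f (fun=> a)); [exact: fc|exact: cvg_cst].
Qed.

Lemma continuous_mul (R : realType) (S : topologicalType) (f g : S -> R) :
  continuous f -> continuous g -> continuous (fun h => f h * g h).
Proof. by move=> fc gc h; apply: (@cvgM _ _ (nbhs h) _ f g); [exact: fc|exact: gc]. Qed.

(* A functional on T is represented by its values g i on the spanning family
   (r_i) and a functional on A by its values q j on (E_j); rho |-> a rho and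
   F |-> b F are the coordinates in these families, and u those of the identity. *)
Definition response_cone (R : realType) (I : finType) (Th : Type)
    (a : Th -> I -> R) (g : I -> R) : Prop :=
  (forall i, 0 <= g i) /\ forall t, 0 <= \sum_i a t i * g i.

(** The box bounds encode positivity on E_j and I - E_j, and confine the values to a compact
    cube. *)
Definition state_body (R : realType) (J : finType) (Sg : Type)
    (b : Sg -> J -> R) (u q : J -> R) : Prop :=
  [/\ forall j, 0 <= q j <= 1, forall s, 0 <= \sum_j b s j * q j
    & \sum_j u j * q j = 1].

Lemma response_coneZ (R : realType) (I : finType) (Th : Type)
    (a : Th -> I -> R) (c : R) (g : I -> R) :
  0 <= c -> response_cone a g -> response_cone a (fun i => c * g i).
Proof.
move=> c0 [g0 ag]; split=> [i|t]; first by rewrite mulr_ge0.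
under eq_bigr do rewrite mulrCA.
by rewrite -mulr_sumr mulr_ge0.
Qed.

(** The number of terms may grow as [e] shrinks. Reduction to |I||J| terms puts all approximations
    into one finite-dimensional cube, where the total error is continuous and attains its infimum
    0. *)
Lemma separable_closed (R : realType) (I J : finType) (Th Sg : Type)
    (a : Th -> I -> R) (b : Sg -> J -> R) (u : J -> R) (M : I -> J -> R) (i0 : I) :
  (forall e, 0 < e -> exists (k : nat) (g : 'I_k -> I -> R) (q : 'I_k -> J -> R),
    [/\ forall x, response_cone a (g x), forall x, state_body b u (q x),
        forall i, \sum_x g x i = 1 &
        forall i j, `|\sum_x g x i * q x j - M i j| <= e]) ->
  exists (k : nat) (g : 'I_k -> I -> R) (q : 'I_k -> J -> R),
    [/\ forall x, response_cone a (g x), forall x, state_body b u (q x) &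
        forall i j, \sum_x g x i * q x j = M i j].
Proof.
move=> approx; pose N := #|{: I * J}|.
pose Z : finType := ('I_N * I + 'I_N * J)%type.
pose gh (h : {ptws Z -> R}) (l : 'I_N) (i : I) : R := h (inl (l, i)).
pose qh (h : {ptws Z -> R}) (l : 'I_N) (j : J) : R := h (inr (l, j)).
pose S : set {ptws Z -> R} :=
  [set h | [/\ forall z, 0 <= h z <= 1,
     forall l, response_cone a (gh h l) & forall l, state_body b u (qh h l)]].
pose F (h : {ptws Z -> R}) : R :=
  \sum_i \sum_j `|\sum_l gh h l i * qh h l j - M i j|.
have ghc l i : continuous (fun h => gh h l i) by exact: ptws_eval_continuous.
have qhc l j : continuous (fun h => qh h l j) by exact: ptws_eval_continuous.
have sumc (K : finType) (c : K -> R) (f : K -> {ptws Z -> R} -> R) :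
    (forall k, continuous (f k)) -> continuous (fun h => \sum_k c k * f k h).
  move=> fc; apply: continuous_bigsum => k.
  by apply: continuous_mul; [exact: cst_continuous|exact: fc].
have Scl : closed S.
  have -> : S = \bigcap_z ([set h | 0 <= h z] `&` [set h | h z <= 1]) `&`
     \bigcap_l \bigcap_t [set h | 0 <= \sum_i a t i * gh h l i] `&`
     \bigcap_l (\bigcap_s [set h | 0 <= \sum_j b s j * qh h l j] `&`
                [set h | \sum_j u j * qh h l j = 1]).
    rewrite eqEsubset; split=> h.
      move=> [hbox hg hq]; split; [split|].
      - by move=> z _; have /andP[] := hbox z.
      - by move=> l _ t _; case: (hg l) => _; apply.
      - by move=> l _; case: (hq l) => _ hs hu; split=> // s _; exact: hs.
    move=> [[hbox hg] hq]; have {}hbox z : 0 <= h z <= 1.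
      by have [] := hbox z Logic.I => /= -> ->.
    split=> // l; split.
    - by move=> i; have /andP[] := hbox (inl (l, i)).
    - by move=> t; exact: (hg l Logic.I t Logic.I).
    - by move=> j; exact: hbox.
    - by move=> s; have [+ _] := hq l Logic.I; apply.
    - by have [_] := hq l Logic.I.
  apply: closedI; [apply: closedI|]; apply: closed_bigI => z _.
  - apply: closedI; first exact/closed_ge_continuous/ptws_eval_continuous.
    exact/closed_le_continuous/ptws_eval_continuous.
  - by apply: closed_bigI => t _; apply/closed_ge_continuous/sumc.
  - apply: closedI; last exact/closed_eq_continuous/sumc.
    by apply: closed_bigI => t _; apply/closed_ge_continuous/sumc.
have Fc : continuous F.
  apply: continuous_bigsum => i; apply: continuous_bigsum => j.
  apply: continuous_dist; apply: continuous_bigsum => l.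
  by apply: continuous_mul; [exact: ghc|exact: qhc].
have F0 h : S h -> 0 <= F h.
  by move=> _; apply: sumr_ge0 => i _; apply: sumr_ge0.
have [h [hbox hg hq] Fh] : exists2 h, S h & F h = 0.
  apply: ptws_compact_zero => // [h []//|e e0].
  have IJ0 : 0 <= #|{: I * J}|%:R :> R by rewrite ler0n.
  (* The |I||J| errors of this size add up to at most [e]; the extra 1 keeps the denominator
     positive when [J] is empty. *)
  have d0 : 0 < e / (#|{: I * J}|%:R + 1) by rewrite divr_gt0// ltr_wpDl.
  have [k [g [q [Hg Hq g1 Hgq]]]] := approx _ d0.
  (* The index [i0] excludes the empty decomposition, whose responses cannot sum to 1. *)
  have k0 : (0 < k)%N.
    by case: k g q Hg Hq g1 Hgq => // g q _ _ /(_ i0); rewrite big_ord0 => /eqP;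
      rewrite eq_sym oner_eq0.
  have [g' [q' [Hg' Hq' E]]] := caratheodory_products (@response_coneZ _ _ _ a) k0 Hg Hq.
  pose h (z : Z) : R := match z with inl li => g' li.1 li.2 | inr lj => q' lj.1 lj.2 end.
  (* The total of the responses is the combination of the product sums with coefficients [u]. The
     reduced family has the same product sums, so its responses also total 1, which bounds each of
     them by 1. *)
  have massE n (f : 'I_n -> I -> R) (r : 'I_n -> J -> R) i :
      (forall x, state_body b u (r x)) ->
      \sum_x f x i = \sum_j u j * \sum_x f x i * r x j.
    move=> Hr; under [RHS]eq_bigr do rewrite mulr_sumr.
    rewrite exchange_big /=; apply: eq_bigr => x _.
    under eq_bigr do rewrite mulrCA.
    by have [_ _ ru] := Hr x; rewrite -mulr_sumr ru mulr1.
  have g'1 i : \sum_l g' l i = 1.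
    by rewrite (massE _ _ _ _ Hq') -(g1 i) (massE _ _ _ _ Hq); under eq_bigr do rewrite E.
  exists (h : {ptws Z -> R}).
    split=> // -[[l i]|[l j]] /=; last by case: (Hq' l).
    have [g'0 _] := Hg' l; rewrite g'0 /= -(g'1 i) (bigD1 l)//= lerDl sumr_ge0//.
    by move=> l' _; case: (Hg' l').
  rewrite /F /gh /qh /=.
  have : \sum_i \sum_j `|\sum_l g' l i * q' l j - M i j| <=
    \sum_(i : I) \sum_(j : J) e / (#|{: I * J}|%:R + 1).
    by apply: ler_sum => i _; apply: ler_sum => j _; rewrite E.
  move/le_trans; apply; rewrite pair_big sumr_const.
  rewrite -[_ *+ _]mulr_natr mulrAC ler_pdivrMr ?ltr_wpDl// ler_pM2l// lerDl//.
exists N, (gh h), (qh h); split=> // i j.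
move/eqP: Fh; rewrite psumr_eq0 => [/allP /(_ i (mem_index_enum i))|i' _]; last exact: sumr_ge0.
rewrite /= psumr_eq0 // => /allP /(_ j (mem_index_enum j)) /=.
by rewrite normr_eq0 subr_eq0 => /eqP.
Qed.

Local Close Scope classical_set_scope.

(** * Functionals on tensor powers *)

Definition site (R : realType) (d n : nat) (f : 'I_n -> 'M[R[i]]_d) (k0 : 'I_n)
  (E : 'M[R[i]]_d) (k : 'I_n) : 'M[R[i]]_d := if k == k0 then E else f k.

Lemma eq_tr_tens (R : realType) (d n : nat) (X : opn R d n) (As Bs : 'I_n -> 'M[R[i]]_d) :
  As =1 Bs -> tr_tens X As = tr_tens X Bs.
Proof.
move=> AB; apply: eq_bigr => s _; apply: eq_bigr => t _; congr (_ * _).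
by apply: eq_bigr => k _; rewrite AB.
Qed.

(** Multilinearity in all factors at once: summing over a box of outcome strings coarse-grains the
    effect at each site. *)
Lemma tr_tens_family (R : realType) (d n : nat) (B : finType) (X : opn R d n)
    (Q : 'I_n -> pred B) (F : 'I_n -> B -> 'M[R[i]]_d) :
  tr_tens X (fun k => \sum_(b | Q k b) F k b) =
  \sum_(w : {ffun 'I_n -> B} | w \in family Q) tr_tens X (fun k => F k (w k)).
Proof.
rewrite /tr_tens [RHS]exchange_big; apply: eq_bigr => s _.
rewrite [RHS]exchange_big; apply: eq_bigr => t _ /=.
rewrite -mulr_sumr; congr (_ * _); under eq_bigr do rewrite summxE.
exact: bigA_distr_big_dep.
Qed.

Lemma tr_tens_site (R : realType) (d n : nat) (X : opn R d n)
    (f : 'I_n -> 'M[R[i]]_d) (k0 : 'I_n) (J : finType) (c : J -> R[i]) (E : J -> 'M[R[i]]_d) :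
  tr_tens X (site f k0 (\sum_j c j *: E j)) = \sum_j c j * tr_tens X (site f k0 (E j)).
Proof.
under [RHS]eq_bigr do rewrite /tr_tens mulr_sumr.
rewrite [RHS]exchange_big; apply: eq_bigr => s _.
under [RHS]eq_bigr do rewrite mulr_sumr.
rewrite [RHS]exchange_big; apply: eq_bigr => t _ /=.
have siteE E' : \prod_k site f k0 E' k (t k) (s k) =
    E' (t k0) (s k0) * \prod_(k | k != k0) f k (t k) (s k).
  rewrite (bigD1 k0)//= /site eqxx; congr (_ * _).
  by apply: eq_bigr => k /negPf ->.
rewrite siteE summxE mulr_suml mulr_sumr; apply: eq_bigr => j _.
by rewrite siteE mxE -mulrA mulrCA.
Qed.

Lemma tr_tens1 (R : realType) (d n : nat) (X : opn R d n) :
  tr_tens X (fun=> 1%:M) = trn X.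
Proof.
apply: eq_bigr => s _; rewrite (bigD1 s)//= [X in _ + X]big1 => [|t ts].
  by rewrite big1 ?mulr1 ?addr0// => k _; rewrite mxE eqxx.
have [k tk] : exists k, t k != s k.
  by apply/existsP; rewrite -negb_forall; apply: contra ts => /eqfunP H; apply/eqP/ffunP.
by rewrite (bigD1 k)//= mxE (negPf tk) mul0r mulr0.
Qed.

(** Off [k0] the identities contribute Kronecker deltas, whose product is the agreement condition of
    [ptr_keep]; the rest regroups index strings by their entry at [k0]. *)
Lemma tr_tens_marginal (R : realType) (d n : nat) (X : opn R d n) (k0 : 'I_n)
    (E : 'M[R[i]]_d) :
  \tr (E *m ptr_keep k0 X) = tr_tens X (site (fun=> 1%:M) k0 E).
Proof.
pose agree (s t : tidx d n) := [forall j, (j != k0) ==> (t j == s j)].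
have prodE (s t : tidx d n) :
    \prod_k site (fun=> 1%:M) k0 E k (t k) (s k) = (agree s t)%:R * E (t k0) (s k0).
  rewrite (bigD1 k0)//= {1}/site eqxx mulrC; congr (_ * _).
  have [/forallP st|] := boolP (agree s t).
    rewrite big1// => k kk0; have := st k; rewrite kk0 => /eqP ->.
    by rewrite /site (negPf kk0) mxE eqxx.
  rewrite negb_forall => /existsP[k]; rewrite negb_imply => /andP[kk0 tk].
  by rewrite (bigD1 k)//= /site (negPf kk0) mxE (negPf tk) mul0r.
transitivity (\sum_(a : 'I_d) \sum_(b : 'I_d) \sum_(s : tidx d n | s k0 == b)
   \sum_(t : tidx d n | (t k0 == a) && agree s t) X s t * E (t k0) (s k0)).
  apply: eq_bigr => a _; rewrite mxE; apply: eq_bigr => b _; rewrite mxE mulr_sumr.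
  apply: eq_bigr => s /eqP sb; rewrite mulr_sumr; apply: eq_bigr => t /andP[/eqP ta _].
  by rewrite ta sb mulrC.
transitivity (\sum_(s : tidx d n) \sum_(a : 'I_d)
    \sum_(t : tidx d n | (t k0 == a) && agree s t) X s t * E (t k0) (s k0)).
  rewrite exchange_big /= [RHS](partition_big (fun s : tidx d n => s k0) xpredT)//=.
  by apply: eq_bigr => b _; rewrite exchange_big.
apply: eq_bigr => s _.
rewrite [RHS](partition_big (fun t : tidx d n => t k0) xpredT)//=.
apply: eq_bigr => a _; rewrite big_mkcondr /=; apply: eq_bigr => t _.
by rewrite prodE; case: (agree s t); rewrite ?mul1r ?mul0r ?mulr0.
Qed.

Definition reindex_op (R : realType) (d n : nat) (p : 'S_n) (X : opn R d n) : opn R d n :=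
  fun s t => X [ffun k => s (p k)] [ffun k => t (p k)].

Lemma tr_tens_reindex (R : realType) (d n : nat) (p : 'S_n) (X : opn R d n)
    (As : 'I_n -> 'M[R[i]]_d) :
  tr_tens (reindex_op p X) As = tr_tens X (fun k => As (p k)).
Proof.
pose h (s : tidx d n) : tidx d n := [ffun k => s (p k)].
have hbij : bijective h.
  exists (fun s : tidx d n => [ffun k => s ((p^-1)%g k)]) => s; apply/ffunP => k.
    by rewrite !ffunE permKV.
  by rewrite !ffunE permK.
rewrite [RHS](reindex h) /=; last exact: onW_bij.
apply: eq_bigr => s _; rewrite [RHS](reindex h) /=; last exact: onW_bij.
apply: eq_bigr => t _; congr (_ * _).
rewrite (reindex_inj (@perm_inj _ p)); apply: eq_bigr => k _.
by rewrite !ffunE.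
Qed.

Definition symmetrize (R : realType) (d n : nat) (X : opn R d n) : opn R d n :=
  fun s t => n`!%:R^-1 * \sum_(p : 'S_n) reindex_op p X s t.

Lemma tr_tens_symmetrize (R : realType) (d n : nat) (X : opn R d n)
    (As : 'I_n -> 'M[R[i]]_d) :
  tr_tens (symmetrize X) As =
  n`!%:R^-1 * \sum_(p : 'S_n) tr_tens X (fun k => As (p k)).
Proof.
under [in RHS]eq_bigr do rewrite -tr_tens_reindex.
rewrite exchange_big mulr_sumr; apply: eq_bigr => s _.
rewrite exchange_big mulr_sumr; apply: eq_bigr => t _.
by rewrite /= -mulr_suml mulrA.
Qed.

Lemma symmetrize_perm (R : realType) (d n : nat) (X : opn R d n) (p : 'S_n)
    (As : 'I_n -> 'M[R[i]]_d) :
  tr_tens (symmetrize X) (fun k => As (p k)) = tr_tens (symmetrize X) As.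
Proof.
rewrite !tr_tens_symmetrize [in RHS](reindex_inj (mulIg p)); congr (_ * _).
apply: eq_bigr => q _; apply: eq_tr_tens => k.
by rewrite permM.
Qed.

(** Averaging over permutations of the sites keeps every clause: all are linear or convex in the
    map, and a permuted copy only moves the marginal to another site, where it has the same
    value. *)
Lemma symmetric_broadcast (R : realType) (d n : nat) (T A : 'M[R[i]]_d -> Prop) :
  pseudo_broadcastable T A n ->
  exists Xi : 'M[R[i]]_d -> opn R d n,
    [/\ linear_map Xi /\ (forall X, tr_tens (Xi X) (fun=> 1%:M) = \tr X),
        forall X (p : 'S_n) As, tr_tens (Xi X) (fun k => As (p k)) = tr_tens (Xi X) As,
        forall k rho E, T rho -> A E ->
          tr_tens (Xi rho) (site (fun=> 1%:M) k E) = \tr (rho *m E) &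
        forall rho As, T rho -> (forall k, A (As k)) -> 0 <= tr_tens (Xi rho) As].
Proof.
have fact0 : n`!%:R != 0 :> R[i] by rewrite pnatr_eq0 -lt0n fact_gt0.
have meanE (c : R[i]) : n`!%:R^-1 * \sum_(p : 'S_n) c = c.
  by rewrite sumr_const card_Sn -[c *+ _]mulr_natl mulKf.
case=> Xi [lin [trXi [marg pos]]].
exists (fun X => symmetrize (Xi X)); split=> [|X p As|k rho E Tr AE|rho As Tr AAs].
- split=> [a X Y s t|X].
    rewrite /symmetrize mulrCA -mulrDr; congr (_ * _); rewrite mulr_sumr -big_split.
    by apply: eq_bigr => p _; rewrite /reindex_op lin.
  by rewrite tr_tens_symmetrize tr_tens1 trXi meanE.
- exact: symmetrize_perm.
- rewrite tr_tens_symmetrize mxtrace_mulC -[RHS]meanE; congr (_ * _).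
  apply: eq_bigr => p _; rewrite -(marg ((p^-1)%g k) _ _ Tr AE) tr_tens_marginal.
  by apply: eq_tr_tens => j; rewrite /site -[j == _](inj_eq (@perm_inj _ p)) permKV.
- rewrite tr_tens_symmetrize mulr_ge0 ?invr_ge0 ?ler0n// sumr_ge0// => p _.
  exact: pos.
Qed.

(** * Measuring a symmetric operator *)

Definition outcome (R : realType) (d : nat) (E : 'M[R[i]]_d) (b : bool) :=
  if b then E else 1%:M - E.

Lemma outcome_total (R : realType) (d : nat) (E : 'M[R[i]]_d) :
  \sum_b outcome E b = 1%:M.
Proof. by rewrite big_bool /= addrC subrK. Qed.

(** The probability of the outcome string [w] when [X] broadcasts a state and each [e k] lies in
    [A]; the real part makes it real-valued in general. *)
Definition joint (R : realType) (d n : nat) (X : opn R d n)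
    (e : 'I_n -> 'M[R[i]]_d) (w : {ffun 'I_n -> bool}) : R :=
  complex.Re (tr_tens X (fun k => outcome (e k) (w k))).

Lemma Re_sum (R : rcfType) (I : finType) (P : pred I) (F : I -> R[i]) :
  complex.Re (\sum_(i | P i) F i) = \sum_(i | P i) complex.Re (F i).
Proof. by apply: (big_morph (@complex.Re R)) => // -[? ?] [? ?]. Qed.

Lemma joint_family (R : realType) (d n : nat) (X : opn R d n)
    (e : 'I_n -> 'M[R[i]]_d) (Q : 'I_n -> pred bool) :
  \sum_(w : {ffun 'I_n -> bool} | w \in family Q) joint X e w =
  complex.Re (tr_tens X (fun k => \sum_(b | Q k b) outcome (e k) b)).
Proof. by rewrite tr_tens_family Re_sum. Qed.

Lemma joint_total (R : realType) (d n : nat) (X : opn R d n)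
    (e : 'I_n -> 'M[R[i]]_d) :
  \sum_w joint X e w = complex.Re (tr_tens X (fun=> 1%:M)).
Proof.
rewrite -(eq_tr_tens _ (fun k => outcome_total (e k))) -(joint_family _ _ (fun=> xpredT)).
by apply: eq_bigl => w; apply/esym/familyP.
Qed.

(** Exchangeability replaces independence. Swapping the sites [a i'] and [b i'], where the same
    effect is measured, preserves the weights, flips the sign of the i'-th difference and fixes the
    i-th, so their correlation equals its own negative. *)
Lemma joint_swap_deviation (R : realType) (d n N : nat) (X : opn R d N)
    (e : 'I_N -> 'M[R[i]]_d) (a b : 'I_n -> 'I_N) (eps : R) :
  (forall (p : 'S_N) As, tr_tens X (fun k => As (p k)) = tr_tens X As) ->
  (forall w, 0 <= joint X e w) -> tr_tens X (fun=> 1%:M) = 1 ->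
  injective a -> injective b -> (forall i i', a i != b i') ->
  (forall i, e (a i) = e (b i)) -> 0 < eps -> 1 <= n%:R * eps ^+ 2 ->
  \sum_w joint X e w * `|n%:R^-1 * \sum_i ((w (a i))%:R - (w (b i))%:R)| <= eps.
Proof.
move=> symX joint0 X1 ainj binj ab eab eps0 neps.
apply: (@paired_mean_deviation _ _ _ _ (fun i (w : {ffun 'I_N -> bool}) =>
  (w (a i))%:R - (w (b i))%:R)) => //.
- by rewrite joint_total X1.
- by move=> i w; case: (w _); case: (w _);
  rewrite ?subrr ?subr0 ?sub0r ?normrN ?normr0 ?normr1 ?ler01.
move=> i i' ii'; set S := \sum_w _.
pose t := tperm (a i') (b i').
pose h (w : {ffun 'I_N -> bool}) := [ffun k => w (t k)] : {ffun 'I_N -> bool}.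
have hK : involutive h by move=> w; apply/ffunP => k; rewrite !ffunE tpermK.
have et k : e (t k) = e k by rewrite /t; case: tpermP => // ->; rewrite eab.
have jointh w : joint X e (h w) = joint X e w.
  congr complex.Re; rewrite -[RHS](symX t); apply: eq_tr_tens => k.
  by rewrite et ffunE.
suff : S = - S by lra.
rewrite /S [LHS](reindex_inj (inv_inj hK)) -sumrN; apply: eq_bigr => w _.
have ta : t (a i) = a i.
  by rewrite /t tpermD// ?(inj_eq ainj) eq_sym// ab.
have tb : t (b i) = b i.
  by rewrite /t tpermD// ?(inj_eq binj) eq_sym// eq_sym ab.
rewrite jointh !ffunE ta tb /t tpermL tpermR.
by rewrite -[in RHS]mulrN -[in RHS]mulrN opprB.
Qed.

Lemma measured_site (R : realType) (d : nat) (e : 'M[R[i]]_d) (b : bool) :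
  \sum_(c | c == b) outcome e c = outcome e b.
Proof. exact: big_pred1_eq. Qed.

Lemma accepted_site (R : realType) (d : nat) (e : 'M[R[i]]_d) :
  \sum_(c : bool | c) outcome e c = e.
Proof. by rewrite (big_pred1 true)// => -[]. Qed.

(* The sites [inl (j, i)] carry the i-th measurement of the j-th effect, the
   sites [inr i] the systems whose conditional state is compared with it. *)
Definition sites (J : finType) (n : nat) : finType := (J * 'I_n + 'I_n)%type.

Definition test_site (J : finType) (n : nat) (y : J * 'I_n) : 'I_#|{: sites J n}| :=
  enum_rank (inl y : sites J n).

Definition free_site (J : finType) (n : nat) (i : 'I_n) : 'I_#|{: sites J n}| :=
  enum_rank (inr i : sites J n).

Definition test (R : realType) (d n : nat) (J : finType) (E : J -> 'M[R[i]]_d)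
    (x : {ffun J * 'I_n -> bool}) (k : 'I_#|{: sites J n}|) : 'M[R[i]]_d :=
  match enum_val k with inl y => outcome (E y.1) (x y) | inr _ => 1%:M end.

(** The functional phi_x of the overview, an estimate that depends on the outcomes alone and not on
    the state. *)
Definition frequency (R : realType) (J : finType) (n : nat)
    (x : {ffun J * 'I_n -> bool}) (j : J) : R :=
  n%:R^-1 * \sum_i (x (j, i))%:R.

Definition test_prob (R : realType) (d n : nat) (J : finType) (E : J -> 'M[R[i]]_d)
    (X : opn R d #|{: sites J n}|) (x : {ffun J * 'I_n -> bool}) : R :=
  complex.Re (tr_tens X (test E x)).

(* Unnormalised: to be divided by [test_prob E X x]. *)
Definition conditional_state (R : realType) (d n : nat) (J : finType)
    (E : J -> 'M[R[i]]_d) (X : opn R d #|{: sites J n}|)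
    (x : {ffun J * 'I_n -> bool}) (F : 'M[R[i]]_d) : R :=
  n%:R^-1 * \sum_i complex.Re (tr_tens X (site (test E x) (free_site J i) F)).

(** Unlike in [test], the free sites are measured too, so that test and free outcomes live in one
    joint distribution and can be swapped. *)
Definition setting (R : realType) (d n : nat) (J : finType) (E : J -> 'M[R[i]]_d)
    (F : 'M[R[i]]_d) (k : 'I_#|{: sites J n}|) : 'M[R[i]]_d :=
  match enum_val k with inl y => E y.1 | inr _ => F end.

(** A site-wise predicate, so that [joint_family] applies to the set of strings extending [x]. *)
Definition compatible (J : finType) (n : nat) (x : {ffun J * 'I_n -> bool})
    (k : 'I_#|{: sites J n}|) (b : bool) : bool :=
  match enum_val k with inl y => b == x y | inr _ => true end.

Lemma compatibleP (J : finType) (n : nat) (x : {ffun J * 'I_n -> bool})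
    (w : {ffun 'I_#|{: sites J n}| -> bool}) :
  (w \in family (compatible x)) = ([ffun y => w (test_site y)] == x).
Proof.
apply/familyP/eqP => [wx|<- k].
  apply/ffunP => y; rewrite ffunE; have := wx (test_site y).
  by rewrite unfold_in /compatible enum_rankK => /eqP.
rewrite unfold_in /compatible; case E: (enum_val k) => [y|//].
by rewrite ffunE /test_site -E enum_valK.
Qed.

Lemma test_prob_joint (R : realType) (d n : nat) (J : finType)
    (E : J -> 'M[R[i]]_d) (F : 'M[R[i]]_d) (X : opn R d #|{: sites J n}|) x :
  \sum_(w | w \in family (compatible x)) joint X (setting E F) w = test_prob E X x.
Proof.
rewrite joint_family; congr complex.Re; apply: eq_tr_tens => k.
rewrite /compatible /setting /test; case: (enum_val k) => [y|i].
  exact: measured_site.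
exact: outcome_total.
Qed.

(** The factor given by the free outcome tightens the predicate at that site to [true], leaving [F]
    there, while the other free sites sum to the identity. *)
Lemma conditional_state_joint (R : realType) (d n : nat) (J : finType)
    (E : J -> 'M[R[i]]_d) (F : 'M[R[i]]_d) (X : opn R d #|{: sites J n}|) x i :
  \sum_(w | w \in family (compatible x))
     joint X (setting E F) w * (w (free_site J i))%:R =
  complex.Re (tr_tens X (site (test E x) (free_site J i) F)).
Proof.
pose Q (k : 'I_#|{: sites J n}|) (b : bool) :=
  compatible x k b && ((k == free_site J i) ==> b).
transitivity (\sum_(w : {ffun _ -> bool} | w \in family Q) joint X (setting E F) w).
  rewrite [LHS]big_mkcond [RHS]big_mkcond; apply: eq_bigr => w _.
  have -> : (w \in family Q) = (w \in family (compatible x)) && w (free_site J i).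
    apply/familyP/andP => [wQ|[/familyP wx wi] k].
      split; first by apply/familyP => k; have /andP[] := wQ k.
      by have /andP[_] := wQ (free_site J i); rewrite eqxx.
    rewrite unfold_in /Q; apply/andP; split; first exact: wx.
    by apply/implyP => /eqP ->.
  by case: (_ \in _) => //=; case: (w _); rewrite ?mulr1 ?mulr0.
rewrite joint_family; congr complex.Re; apply: eq_tr_tens => k.
rewrite /site /Q; have [->|ki] := eqVneq k (free_site J i).
  by rewrite /compatible /setting enum_rankK; exact: accepted_site.
rewrite /compatible /setting /test; case: (enum_val k) => [y|i'].
  by under eq_bigl do rewrite andbT; exact: measured_site.
exact: outcome_total.
Qed.

(** With E_j measured on the free sites as well, the difference at [x] is a sum, over the strings
    extending [x], of mean test-minus-free outcomes. The triangle inequality inside each such fibre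
    reduces the claim to [joint_swap_deviation]. *)
Lemma frequency_deviation (R : realType) (d n : nat) (J : finType)
    (E : J -> 'M[R[i]]_d) (X : opn R d #|{: sites J n}|) (j : J) (eps : R) :
  (forall (p : 'S__) As, tr_tens X (fun k => As (p k)) = tr_tens X As) ->
  (forall w, 0 <= joint X (setting E (E j)) w) -> tr_tens X (fun=> 1%:M) = 1 ->
  0 < eps -> 1 <= n%:R * eps ^+ 2 ->
  \sum_x `|test_prob E X x * frequency R x j - conditional_state E X x (E j)| <= eps.
Proof.
move=> symX joint0 X1 eps0 neps.
have inj_test : injective (fun i : 'I_n => test_site (j, i)).
  by move=> i i' /enum_rank_inj[].
have inj_free : injective (@free_site J n) by move=> i i' /enum_rank_inj[].
have disj i i' : test_site (j, i) != @free_site J n i' by rewrite (inj_eq enum_rank_inj).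
have same i : setting E (E j) (test_site (j, i)) = setting E (E j) (@free_site J n i).
  by rewrite /setting !enum_rankK.
apply: le_trans (joint_swap_deviation symX joint0 X1 inj_test inj_free disj same eps0 neps).
rewrite [leRHS](partition_big
  (fun w : {ffun _ -> bool} => [ffun y => w (test_site y)]) xpredT)//=.
apply: ler_sum => x _; under eq_bigl do rewrite -compatibleP.
apply: le_trans (ler_sum _ _); last first.
  by move=> w _; rewrite -[X in X * _]ger0_norm// -normrM; exact: lexx.
apply: le_trans (ler_norm_sum _ _ _); rewrite le_eqVlt; apply/orP; left.
apply/eqP; congr (`|_|).
rewrite -(test_prob_joint E (E j)) /conditional_state.
under [in RHS]eq_bigr => w wx.
  rewrite sumrB mulrBr mulrBr; over.
rewrite sumrB mulr_suml; congr (_ - _).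
  apply: eq_bigr => w; rewrite compatibleP => /eqP <-; congr (_ * (_ * _)).
  by apply: eq_bigr => i _; rewrite ffunE.
under eq_bigr do rewrite -conditional_state_joint.
rewrite exchange_big mulr_sumr; apply: eq_bigr => w _ /=.
by rewrite -mulr_sumr mulrCA.
Qed.

(** * Approximate decompositions from broadcasting maps *)

Lemma Re_ge0 (R : rcfType) (z : R[i]) : 0 <= z -> 0 <= complex.Re z.
Proof. by rewrite lecE => /andP[]. Qed.

Lemma Re_mul_real (R : rcfType) (c z : R[i]) :
  c \is Num.real -> complex.Re (c * z) = complex.Re c * complex.Re z.
Proof. by case/complex_realP => k ->; case: z => a b /=; rewrite mul0r subr0. Qed.

Lemma linear_map_sum (R : realType) (d n : nat) (Xi : 'M[R[i]]_d -> opn R d n)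
    (I : finType) (c : I -> R[i]) (r : I -> 'M[R[i]]_d) (s t : tidx d n) :
  linear_map Xi -> Xi (\sum_i c i *: r i) s t = \sum_i c i * Xi (r i) s t.
Proof.
move=> lin; elim/big_rec2: _ => [|i y X _ <-]; last by rewrite lin.
(* The empty sum: linearity with coefficient -1 and both arguments zero forces [Xi 0] to vanish. *)
by have := lin (-1) 0 0 s t; rewrite scaler0 addr0 mulN1r addNr.
Qed.

Lemma tr_tens_linear_map (R : realType) (d n : nat) (Xi : 'M[R[i]]_d -> opn R d n)
    (I : finType) (c : I -> R[i]) (r : I -> 'M[R[i]]_d) As :
  linear_map Xi ->
  tr_tens (Xi (\sum_i c i *: r i)) As = \sum_i c i * tr_tens (Xi (r i)) As.
Proof.
move=> lin; under [RHS]eq_bigr do rewrite mulr_sumr.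
rewrite [RHS]exchange_big; apply: eq_bigr => s _.
under [RHS]eq_bigr do rewrite mulr_sumr.
rewrite [RHS]exchange_big; apply: eq_bigr => t _.
rewrite linear_map_sum// mulr_suml; apply: eq_bigr => i _.
by rewrite mulrA.
Qed.

Lemma joint_marginal (R : realType) (d n : nat) (X : opn R d n)
    (e : 'I_n -> 'M[R[i]]_d) (k0 : 'I_n) :
  \sum_w joint X e w * (w k0)%:R =
  complex.Re (tr_tens X (site (fun=> 1%:M) k0 (e k0))).
Proof.
pose Q (k : 'I_n) (b : bool) := (k == k0) ==> b.
transitivity (\sum_(w : {ffun _ -> bool} | w \in family Q) joint X e w).
  rewrite [RHS]big_mkcond; apply: eq_bigr => w _.
  have -> : (w \in family Q) = w k0.
    apply/familyP/idP => [/(_ k0)|wk0 k]; rewrite unfold_in /Q ?eqxx//.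
    by apply/implyP => /eqP ->.
  by case: (w _); rewrite ?mulr1 ?mulr0.
rewrite joint_family; congr complex.Re; apply: eq_tr_tens => k.
rewrite /site /Q; have [->|kk0] := eqVneq k k0; first exact: accepted_site.
exact: outcome_total.
Qed.

(** The frequencies are unbiased: each of the [n] test sites of [j] contributes its own one-site
    marginal [m]. *)
Lemma test_prob_frequency (R : realType) (d n : nat) (J : finType)
    (E : J -> 'M[R[i]]_d) (X : opn R d #|{: sites J n}|) (j : J) (m : R) :
  (0 < n)%N ->
  (forall k, complex.Re (tr_tens X (site (fun=> 1%:M) k (E j))) = m) ->
  \sum_x test_prob E X x * frequency R x j = m.
Proof.
move=> n0 mE; have nn0 : n%:R != 0 :> R by rewrite pnatr_eq0 -lt0n.
transitivity (\sum_w joint X (setting E (E j)) w *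
    (n%:R^-1 * \sum_(i < n) (w (test_site (j, i)))%:R)).
  rewrite [RHS](partition_big
    (fun w : {ffun _ -> bool} => [ffun y => w (test_site y)]) xpredT)//=.
  apply: eq_bigr => x _; under [RHS]eq_bigl do rewrite -compatibleP.
  rewrite -(test_prob_joint E (E j)) mulr_suml.
  apply: eq_bigr => w; rewrite compatibleP => /eqP <-; congr (_ * (_ * _)).
  by apply: eq_bigr => i _; rewrite ffunE.
under eq_bigr do rewrite mulrCA mulr_sumr.
rewrite -mulr_sumr exchange_big /=.
under eq_bigr => i _.
  rewrite joint_marginal /setting enum_rankK mE; over.
by rewrite sumr_const card_ord -[m *+ n]mulr_natl mulKf.
Qed.

Lemma test_prob_total (R : realType) (d n : nat) (J : finType)
    (E : J -> 'M[R[i]]_d) (X : opn R d #|{: sites J n}|) :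
  \sum_x test_prob E X x = complex.Re (tr_tens X (fun=> 1%:M)).
Proof.
rewrite -(joint_total X (setting E 1%:M)) [RHS](partition_big
    (fun w : {ffun _ -> bool} => [ffun y => w (test_site y)]) xpredT)//=.
apply: eq_bigr => x _; under [RHS]eq_bigl do rewrite -compatibleP.
by rewrite test_prob_joint.
Qed.

Lemma test_effect (R : realType) (d n : nat) (J : finType) (A : 'M[R[i]]_d -> Prop)
    (E : J -> 'M[R[i]]_d) (x : {ffun J * 'I_n -> bool}) k :
  A 1%:M -> (forall F, A F -> A (1%:M - F)) -> (forall j, A (E j)) -> A (test E x k).
Proof.
move=> A1 AC AE; rewrite /test; case: (enum_val k) => [y|//].
by rewrite /outcome; case: (x y); [|apply: AC].
Qed.

Lemma conditional_stateM (R : realType) (d n : nat) (J K : finType)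
    (E : J -> 'M[R[i]]_d) (X : opn R d #|{: sites J n}|) x
    (c : K -> R[i]) (F : K -> 'M[R[i]]_d) :
  (forall k, c k \is Num.real) ->
  conditional_state E X x (\sum_k c k *: F k) =
  \sum_k complex.Re (c k) * conditional_state E X x (F k).
Proof.
move=> creal; rewrite /conditional_state.
under [RHS]eq_bigr do rewrite mulrCA mulr_sumr.
rewrite -mulr_sumr exchange_big; congr (_ * _); apply: eq_bigr => i _ /=.
rewrite tr_tens_site Re_sum; apply: eq_bigr => k _.
exact: Re_mul_real.
Qed.

Lemma conditional_state1 (R : realType) (d n : nat) (J : finType)
    (E : J -> 'M[R[i]]_d) (X : opn R d #|{: sites J n}|) x :
  (0 < n)%N -> conditional_state E X x 1%:M = test_prob E X x.
Proof.
move=> n0; have nn0 : n%:R != 0 :> R by rewrite pnatr_eq0 -lt0n.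
rewrite /conditional_state; under eq_bigr => i _.
  rewrite (@eq_tr_tens _ _ _ _ _ (test E x)); first over.
  move=> k; rewrite /site; case: eqVneq => [->|//].
  by rewrite /test enum_rankK.
by rewrite sumr_const card_ord -[complex.Re _ *+ n]mulr_natl mulKf.
Qed.

(** The coordinates of elements of [A] are real, so the values on the E_j determine the conditional
    state on all of [A], where positivity of [X] applies. The identity has value [test_prob E X x],
    whence the normalisation. *)
Lemma conditional_state_body (R : realType) (d n : nat) (J : finType)
    (A : 'M[R[i]]_d -> Prop) (E D : J -> 'M[R[i]]_d) (X : opn R d #|{: sites J n}|) x :
  (0 < n)%N -> A 1%:M -> (forall F, A F -> A (1%:M - F)) -> (forall j, A (E j)) ->
  (forall F, A F -> F = \sum_j \tr (F *m D j) *: E j) ->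
  (forall F j, A F -> \tr (F *m D j) \is Num.real) ->
  (forall As, (forall k, A (As k)) -> 0 <= tr_tens X As) ->
  0 < test_prob E X x ->
  state_body (fun (F : {F | A F}) j => complex.Re (\tr (sval F *m D j)))
    (fun j => complex.Re (\tr (D j)))
    (fun j => conditional_state E X x (E j) / test_prob E X x).
Proof.
move=> n0 A1 AC AE span real pos p0.
have s0 F : A F -> 0 <= conditional_state E X x F.
  move=> AF; rewrite mulr_ge0 ?invr_ge0 ?ler0n// sumr_ge0// => i _.
  apply/Re_ge0/pos => k; rewrite /site; case: ifP => // _.
  exact: test_effect.
have expand F : A F -> \sum_j complex.Re (\tr (F *m D j)) *
    (conditional_state E X x (E j) / test_prob E X x) =
    conditional_state E X x F / test_prob E X x.
  move=> AF; under eq_bigr do rewrite mulrA.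
  rewrite -mulr_suml [F in RHS]span// conditional_stateM// => j; exact: real.
split=> [j|[F AF]|].
- rewrite divr_ge0 ?s0 ?(ltW p0)//= ler_pdivrMr// mul1r -conditional_state1//.
  (* The upper bound 1 is positivity on I - E_j, by additivity over the two outcomes. *)
  rewrite -(outcome_total (E j)) -subr_ge0.
  under [X in conditional_state _ _ _ X]eq_bigr do rewrite -[outcome _ _]scale1r.
  rewrite (@conditional_stateM _ _ _ _ _ _ _ _ (fun=> 1))//= big_bool /=.
  rewrite mul1r mul1r addrAC subrr add0r.
  exact/s0/AC.
- by rewrite expand//= divr_ge0 ?s0// ltW.
- have := expand _ A1; rewrite conditional_state1// divff ?gt_eqF// => <-.
  by apply: eq_bigr => j _; rewrite mul1mx.
Qed.

Lemma exists_sqr_bound (R : realType) (e : R) :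
  0 < e -> exists2 n, (0 < n)%N & 1 <= n%:R * e ^+ 2.
Proof.
move=> e0; have e2 : 0 < e ^+ 2 by rewrite exprn_gt0.
exists (Num.bound (e ^+ 2)^-1).+1 => //.
rewrite -ler_pdivrMr// mul1r -natr1 ler_wpDr ?ler01//.
by rewrite ltW// archi_boundP// invr_ge0 ltW.
Qed.

(** [q x] nearly minimises the distance to the frequencies over the body, so one choice serves every
    [r i]. The conditional state of each [r i] competes in this minimisation and is close by
    [frequency_deviation]. Half of [eps] pays for near-minimality, half for the deviations. *)
Lemma broadcast_approx (R : realType) (d : nat) (T A : 'M[R[i]]_d -> Prop)
    (I J : finType) (r Dr : I -> 'M[R[i]]_d) (E De : J -> 'M[R[i]]_d) (i0 : I) (eps : R) :
  (forall rho, T rho -> \tr rho = 1) ->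
  A 1%:M -> (forall F, A F -> A (1%:M - F)) ->
  (forall i, T (r i)) -> (forall j, A (E j)) ->
  (forall rho, T rho -> rho = \sum_i \tr (rho *m Dr i) *: r i) ->
  (forall rho i, T rho -> \tr (rho *m Dr i) \is Num.real) ->
  (forall F, A F -> F = \sum_j \tr (F *m De j) *: E j) ->
  (forall F j, A F -> \tr (F *m De j) \is Num.real) ->
  (forall n, pseudo_broadcastable T A n) -> 0 < eps ->
  exists (k : nat) (g : 'I_k -> I -> R) (q : 'I_k -> J -> R),
    [/\ forall x, response_cone
          (fun (rho : {rho | T rho}) i => complex.Re (\tr (sval rho *m Dr i))) (g x),
        forall x, state_body
          (fun (F : {F | A F}) j => complex.Re (\tr (sval F *m De j)))
          (fun j => complex.Re (\tr (De j))) (q x),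
        forall i, \sum_x g x i = 1 &
        forall i j, `|\sum_x g x i * q x j - complex.Re (\tr (r i *m E j))| <= eps].
Proof.
move=> Ttr A1 AC Tr AE spanT realT spanA realA pb eps0.
have J1 : 0 < #|J|%:R + 1 :> R by rewrite ltr_wpDl.
(* A deviation [e] in each of the |J| coordinates costs at most [eps / 2] in total; the extra 1
   covers an empty [J]. *)
pose e := eps / 2 / (#|J|%:R + 1).
have e0 : 0 < e by rewrite !divr_gt0.
have [n n0 ne] := exists_sqr_bound e0.
have [Xi [[lin Xi1] sym marg pos]] := symmetric_broadcast (pb #|{: sites J n}|).
set K := state_body _ _.
pose p i x := test_prob E (Xi (r i)) x.
have p0 i x : 0 <= p i x by apply/Re_ge0/pos => // k; exact: test_effect.
have Xir1 i : tr_tens (Xi (r i)) (fun=> 1%:M) = 1 by rewrite Xi1 Ttr.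
have p1 i : \sum_x p i x = 1 by rewrite test_prob_total Xir1.
have condK i x : 0 < p i x ->
    K (fun j => conditional_state E (Xi (r i)) x (E j) / p i x).
  by move=> pix; apply: (conditional_state_body (A := A)) => // As; exact: pos.
(* The body is nonempty: some outcome has positive probability in [r i0], and its conditional state
   is a point. *)
have K0 : exists q, K q.
  have [x px] : exists x, 0 < p i0 x.
    apply/existsP; rewrite -[[exists _, _]]negbK; apply/negP => /existsPn H.
    have := p1 i0; rewrite big1 => [/eqP|x _]; first by rewrite eq_sym oner_eq0.
    by apply/eqP; have := H x; rewrite lt0r p0 andbT negbK.
  by exists (fun j => conditional_state E (Xi (r i0)) x (E j) / p i0 x); exact: condK.
pose f (x : {ffun J * 'I_n -> bool}) (q : J -> R) := \sum_j `|q j - frequency R x j|.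
have eps2 : 0 < eps / 2 by rewrite divr_gt0.
have nearest x : exists q, K q /\ forall q', K q' -> f x q <= f x q' + eps / 2.
  have [q Kq fq] := near_minimum (f := f x) K0 (fun q => sumr_ge0 _ (fun j _ => normr_ge0 _)) eps2.
  by exists q.
have [q qP] := fin_all_exists nearest.
have freqE i j : \sum_x p i x * frequency R x j = complex.Re (\tr (r i *m E j)).
  by apply: test_prob_frequency => // k; rewrite marg.
exists #|{: {ffun J * 'I_n -> bool}}|, (fun l i => p i (enum_val l)),
  (fun l => q (enum_val l)); split=> [l|l|i|i j].
- split=> [i|[rho Trho]]; first exact: p0.
  (* By linearity of [Xi], extending the responses from the spanning family to [rho] gives the
     outcome probabilities of [rho] itself. *)
  rewrite /= (_ : \sum_i _ = test_prob E (Xi rho) (enum_val l)).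
    by apply/Re_ge0/pos => // k; exact: test_effect.
  rewrite /test_prob [in RHS](spanT _ Trho) tr_tens_linear_map// Re_sum.
  by apply: eq_bigr => i _; rewrite Re_mul_real// realT.
- by case: (qP (enum_val l)).
- by rewrite -(p1 i) [RHS](reindex_onto enum_val enum_rank) //= => [|x _];
    [apply: eq_bigl => l; rewrite enum_valK eqxx|exact: enum_rankK].
have -> : \sum_(l < #|{: {ffun J * 'I_n -> bool}}|) p i (enum_val l) * q (enum_val l) j =
    \sum_x p i x * q x j.
  rewrite [RHS](reindex_onto enum_val enum_rank) //= => [|x _]; last exact: enum_rankK.
  by apply: eq_bigl => l; rewrite enum_valK eqxx.
rewrite -freqE -sumrB (le_trans (ler_norm_sum _ _ _))//.
pose dev x := \sum_j `|p i x * frequency R x j - conditional_state E (Xi (r i)) x (E j)|.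
have step x : `|p i x * q x j - p i x * frequency R x j| <= dev x + p i x * (eps / 2).
  (* An outcome of probability zero has no conditional state, but then the left-hand side
     vanishes. *)
  have [px|px] := eqVneq (p i x) 0.
    by rewrite px !mul0r subrr normr0 addr0 sumr_ge0.
  have {}px : 0 < p i x by rewrite lt0r px p0.
  rewrite -mulrBr normrM (ger0_norm (p0 i x)).
  have [_ /(_ _ (condK _ _ px)) qmin] := qP x.
  have qf : `|q x j - frequency R x j| <= f x (q x).
    by rewrite /f (bigD1 j)//= lerDl sumr_ge0.
  apply: le_trans (ler_wpM2l (p0 i x) (le_trans qf qmin)) _.
  rewrite mulrDr lerD2r /f mulr_sumr; apply: ler_sum => j' _.
  rewrite -{1}(ger0_norm (p0 i x)) -normrM distrC mulrBr.
  by rewrite mulrCA divff ?mulr1// gt_eqF.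
rewrite (le_trans (ler_sum _ (fun x _ => step x)))// big_split /= -mulr_suml p1 mul1r.
rewrite [leRHS]splitr lerD2r exchange_big /=.
apply: (@le_trans _ _ (\sum_(j' : J) e)).
  apply: ler_sum => j' _; apply: frequency_deviation => // w.
  apply/Re_ge0/pos => // k; rewrite /outcome /setting.
  by case: (enum_val k) => [y|_]; case: (w k) => //; exact: AC.
by rewrite sumr_const -[e *+ _]mulr_natr /e mulrAC ler_pdivrMr// ler_pM2l// lerDl.
Qed.

(** * Equivalence of the two notions *)

(** A free sequence in [S] is extended until it spans [S]; reaching length dim V + 1 would
    contradict freeness. *)
Lemma free_spanning_seq (F : fieldType) (V : vectType F) (S : V -> Prop) :
  exists X : seq V, [/\ free X, forall x, x \in X -> S x &
    forall x, S x -> x \in <<X>>%VS].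
Proof.
suff build m : exists X : seq V, [/\ free X, forall x, x \in X -> S x &
    size X = m \/ forall x, S x -> x \in <<X>>%VS].
  have [X [Xfree XS [Xsize|]]] := build (\dim {:V}).+1; last by exists X.
  have := dimvS (subvf <<X>>%VS).
  by move: Xfree; rewrite /free => /eqP ->; rewrite Xsize ltnn.
elim: m => [|m [X [Xfree XS [Xsize|Xspan]]]].
- by exists [::]; split; [exact: nil_free| |left].
- have [Xspan|] := pselect (forall x, S x -> x \in <<X>>%VS).
    by exists X; split=> //; right.
  move=> /existsNP[x /not_implyP[Sx /negP xX]].
  exists (x :: X); split; [by rewrite free_cons xX| |by left; rewrite /= Xsize].
  by move=> y; rewrite inE => /predU1P[->|/XS].
- by exists X; split=> //; right.
Qed.

(** Operators dual to a basis chosen in [S] give the coordinates. Taking adjoints shows that the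
    conjugate coordinates expand [x] as well, so their mean does too; it is real, and it is the
    pairing with the Hermitian part of the dual operator. *)
Lemma hermitian_span_family (R : realType) (d : nat) (S : 'M[R[i]]_d -> Prop) :
  (forall x, S x -> adjmx x = x) ->
  exists (m : nat) (v D : 'I_m -> 'M[R[i]]_d),
    [/\ forall k, S (v k), forall x, S x -> x = \sum_k \tr (x *m D k) *: v k &
        forall x k, S x -> \tr (x *m D k) \is Num.real].
Proof.
move=> Sherm; have [X [Xfree XS Xspan]] := free_spanning_seq S.
pose v (k : 'I_(size X)) := X`_k.
have Sv k : S (v k) by apply/XS/mem_nth.
pose c (k : 'I_(size X)) : 'M[R[i]]_d -> R[i] := coord (in_tuple X) k.
pose D k : 'M[R[i]]_d := \matrix_(a, b) c k (delta_mx b a).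
have trD x k : \tr (x *m D k) = c k x.
  rewrite [in RHS](matrix_sum_delta x) /c linear_sum; apply: eq_bigr => a _.
  rewrite mxE linear_sum; apply: eq_bigr => b _.
  by rewrite linearZ /= /D mxE.
have expand x : S x -> x = \sum_k c k x *: v k.
  by move=> /Xspan; exact: (@coord_span _ _ _ (in_tuple X)).
have trDJ x k : S x -> \tr (x *m adjmx (D k)) = (c k x)^*.
  move=> Sx; rewrite -trD /mxtrace rmorph_sum.
  under eq_bigr do rewrite mxE; under [RHS]eq_bigr do rewrite mxE rmorph_sum.
  rewrite [RHS]exchange_big; apply: eq_bigr => a _; apply: eq_bigr => b _.
  by rewrite rmorphM -[in LHS](Sherm x Sx) !mxE.
have expandJ x : S x -> x = \sum_k (c k x)^* *: v k.
  move=> Sx; apply/matrixP => a b; rewrite -{1}(Sherm x Sx) mxE [in LHS](expand x Sx).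
  rewrite !summxE rmorph_sum; apply: eq_bigr => k _.
  by rewrite !mxE rmorphM -[in RHS](Sherm _ (Sv k)) mxE.
pose H k := 2^-1 *: (D k + adjmx (D k)).
have trH x k : S x -> \tr (x *m H k) = 2^-1 * (c k x + (c k x)^*).
  by move=> Sx; rewrite -scalemxAr mxtraceZ mulmxDr mxtraceD trD trDJ.
exists (size X), v, H; split=> // x; last first.
  by move=> k Sx; rewrite trH// CrealE rmorphM rmorphD /= conjCK addrC fmorphV /= conjC_nat.
move=> Sx; under eq_bigr do rewrite trH// -scalerA scalerDl.
rewrite -scaler_sumr big_split /= -expand// -expandJ//.
by rewrite -mulr2n -[x *+ 2]scaler_nat scalerA mulVf ?scale1r// pnatr_eq0.
Qed.

Lemma noncontextual_empty (R : realType) (d : nat) (T A : 'M[R[i]]_d -> Prop) :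
  (forall rho, ~ T rho) -> MP_noncontextual T A.
Proof.
by move=> T0; exists 0%N, (fun=> 0), (fun=> 0); split; [|split] => [? ? /T0|? /T0|[]].
Qed.

(** The exact limit decomposition consists of real values on the spanning families; the dual
    operators [Dr] and [De] turn these values into the operators [G] and [sigma]. *)
Lemma broadcastable_noncontextual (R : realType) (d : nat) (T A : 'M[R[i]]_d -> Prop) :
  (forall rho, T rho -> is_state rho) -> (forall E, A E -> is_effect E) ->
  A 1%:M -> (forall E, A E -> A (1%:M - E)) ->
  (forall n, pseudo_broadcastable T A n) -> MP_noncontextual T A.
Proof.
move=> Tst Aeff A1 AC pb.
have [[rho0 Trho0]|/forallNP] := pselect (exists rho, T rho); last exact: noncontextual_empty.
have [m [r [Dr [Tr spanT realT]]]] : exists (m : nat) (v D : 'I_m -> 'M[R[i]]_d),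
    [/\ forall k, T (v k), forall x, T x -> x = \sum_k \tr (x *m D k) *: v k &
        forall x k, T x -> \tr (x *m D k) \is Num.real].
  by apply: hermitian_span_family => rho /Tst[[]].
have [p [E [De [AE spanA realA]]]] : exists (m : nat) (v D : 'I_m -> 'M[R[i]]_d),
    [/\ forall k, A (v k), forall x, A x -> x = \sum_k \tr (x *m D k) *: v k &
        forall x k, A x -> \tr (x *m D k) \is Num.real].
  by apply: hermitian_span_family => F /Aeff[[]].
(* The family spanning [T] is nonempty because [rho0] has trace 1, so [ord0] can serve as its
   distinguished index. *)
case: m r Dr Tr spanT realT => [|m] r Dr Tr spanT realT.
  have [_] := Tst _ Trho0; rewrite (spanT _ Trho0) big_ord0 mxtrace0 => /eqP.
  by rewrite eq_sym oner_eq0.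
have [k [g [q [Hg Hq gqE]]]] := separable_closed ord0 (fun eps eps0 =>
  broadcast_approx ord0 (fun rho Trho => (Tst rho Trho).2) A1 AC Tr AE spanT realT
    spanA realA pb eps0).
pose G l := \sum_i (g l i)%:C%C *: Dr i.
pose sigma l := \sum_j (q l j)%:C%C *: De j.
have trG l rho : \tr (rho *m G l) = \sum_i \tr (rho *m Dr i) * (g l i)%:C%C.
  rewrite mulmx_sumr raddf_sum; apply: eq_bigr => i _.
  by rewrite -scalemxAr /= mxtraceZ mulrC.
have trS l F : \tr (sigma l *m F) = \sum_j \tr (F *m De j) * (q l j)%:C%C.
  rewrite mulmx_suml raddf_sum; apply: eq_bigr => j _.
  by rewrite -scalemxAl /= mxtraceZ mxtrace_mulC mulrC.
have real_sum (I : finType) (c : I -> R[i]) (h : I -> R) :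
    (forall i, c i \is Num.real) ->
    \sum_i c i * (h i)%:C%C = (\sum_i complex.Re (c i) * h i)%:C%C.
  move=> creal; rewrite rmorph_sum; apply: eq_bigr => i _.
  by rewrite rmorphM /= RRe_real.
have factor rho F : T rho -> A F ->
    \tr (rho *m F) = \sum_l \tr (rho *m G l) * \tr (sigma l *m F).
  move=> Trho AF.
  under eq_bigr => l _.
    rewrite trG trS mulr_suml; under eq_bigr do rewrite mulr_sumr; over.
  rewrite exchange_big /= {1}(spanT _ Trho) mulmx_suml raddf_sum; apply: eq_bigr => i _.
  rewrite exchange_big /= -scalemxAl /= mxtraceZ {1}(spanA _ AF) mulmx_sumr raddf_sum mulr_sumr.
  apply: eq_bigr => j _; rewrite -scalemxAr /= mxtraceZ.
  (* The trace is real because a broadcasting map to a single system makes it a nonnegative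
     value. *)
  have -> : \tr (r i *m E j) = (complex.Re (\tr (r i *m E j)))%:C%C.
    rewrite RRe_real// ger0_real//.
    have [Xi [_ _ marg pos]] := symmetric_broadcast (pb 1%N).
    rewrite -(marg ord0)//; apply: pos => // l.
    by rewrite /site; case: ifP.
  rewrite -gqE rmorph_sum !mulr_sumr; apply: eq_bigr => l _.
  by rewrite rmorphM /=; ring.
have sigma1 l : \tr (sigma l) = 1.
  have [_ _ qu1] := Hq l.
  rewrite -[sigma l]mulmx1 trS real_sum => [|j]; last exact: realA.
  by under eq_bigr do rewrite mul1mx; rewrite qu1.
exists k, G, sigma; split; [exact: factor|split] => [rho Trho|l].
  split=> [l|].
    rewrite trG real_sum => [|i]; last exact: realT.
    by rewrite ler0c; have [_ /(_ (exist _ rho Trho))] := Hg l.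
  (* Normalisation is the factorisation at E = I, where each [sigma l] has trace 1. *)
  have [_ <-] := Tst _ Trho; rewrite -[X in _ = \tr X]mulmx1 factor//.
  by apply: eq_bigr => l _; rewrite mulmx1 sigma1 mulr1.
split=> // F AF.
rewrite trS real_sum => [|j]; last exact: realA.
by rewrite ler0c; have [_ /(_ (exist _ F AF))] := Hq l.
Qed.

(** * Broadcasting from a non-contextual decomposition *)

Definition product_op (R : realType) (d n k : nat) (G sigma : 'I_k -> 'M[R[i]]_d)
    (X : 'M[R[i]]_d) : opn R d n :=
  fun s t => \sum_l \tr (X *m G l) * \prod_j sigma l (s j) (t j).

Lemma tr_tens_product_op (R : realType) (d n k : nat) (G sigma : 'I_k -> 'M[R[i]]_d)
    (X : 'M[R[i]]_d) (As : 'I_n -> 'M[R[i]]_d) :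
  tr_tens (@product_op R d n k G sigma X) As =
  \sum_l \tr (X *m G l) * \prod_j \tr (sigma l *m As j).
Proof.
transitivity (\sum_l \sum_(s : tidx d n) \sum_(t : tidx d n)
   \tr (X *m G l) * \prod_j (sigma l (s j) (t j) * As j (t j) (s j))).
  rewrite exchange_big; apply: eq_bigr => s _.
  rewrite exchange_big; apply: eq_bigr => t _ /=.
  by rewrite mulr_suml; apply: eq_bigr => l _; rewrite -mulrA big_split.
apply: eq_bigr => l _.
have -> : \prod_j \tr (sigma l *m As j) =
    \prod_j \sum_a \sum_b sigma l a b * As j b a.
  by apply: eq_bigr => j _; apply: eq_bigr => a _; rewrite mxE.
rewrite bigA_distr_bigA mulr_sumr; apply: eq_bigr => s _.
by rewrite bigA_distr_bigA mulr_sumr.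
Qed.

(** On a product operator every traced-out copy of [sigma l] contributes 1, leaving the
    decomposition itself as marginal; joint values are sums of products of nonnegative numbers. *)
Lemma noncontextual_broadcastable (R : realType) (d : nat)
    (T A : 'M[R[i]]_d -> Prop) (n : nat) :
  (forall rho, T rho -> is_state rho) -> A 1%:M ->
  MP_noncontextual T A -> pseudo_broadcastable T A n.
Proof.
move=> Tst A1 [k [G [sigma [factor [Gresp sigmaP]]]]].
(* [G] resolves the identity only on [T]; the defect is added to one of the [G l]. *)
suff [k' [G' [sigma' [sigma1 G'1 agree]]]] : exists k' (G' sigma' : 'I_k' -> 'M[R[i]]_d),
    [/\ forall l, \tr (sigma' l) = 1, forall X, \sum_l \tr (X *m G' l) = \tr X &
      forall rho, T rho -> [/\ forall l, 0 <= \tr (rho *m G' l),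
        forall l E, A E -> 0 <= \tr (sigma' l *m E) &
        forall E, A E -> \tr (rho *m E) = \sum_l \tr (rho *m G' l) * \tr (sigma' l *m E)]].
  exists (@product_op R d n _ G' sigma'); split; [|split; [|split]].
  - move=> a X Y s t; rewrite /product_op mulr_sumr -big_split; apply: eq_bigr => l _.
    by rewrite mulmxDl -scalemxAl mxtraceD mxtraceZ mulrDl mulrA.
  - move=> X; rewrite -tr_tens1 tr_tens_product_op -[RHS]G'1; apply: eq_bigr => l _.
    by rewrite big1 ?mulr1// => j _; rewrite mulmx1.
  - move=> k0 rho E Trho AE; rewrite tr_tens_marginal tr_tens_product_op.
    have [_ _ facE] := agree _ Trho.
    rewrite [RHS]mxtrace_mulC facE//; apply: eq_bigr => l _; congr (_ * _).
    rewrite (bigD1 k0)//= {1}/site eqxx big1 ?mulr1// => j /negPf jk0.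
    by rewrite /site jk0 mulmx1.
  - move=> rho As Trho AAs; have [G0 s0 _] := agree _ Trho.
    rewrite tr_tens_product_op; apply: sumr_ge0 => l _.
    by rewrite mulr_ge0// prodr_ge0// => j _; exact: s0.
case: k G sigma factor Gresp sigmaP => [|k] G sigma factor Gresp sigmaP.
  have T0 rho : ~ T rho.
    by case/Gresp => _ /eqP; rewrite big_ord0 eq_sym oner_eq0.
  (* Here [T] is empty and only trace preservation remains. In dimension 0 all traces vanish and the
     empty family works; otherwise X is sent to tr X times powers of a fixed rank-one projector. *)
  case: d => [|d] in T A Tst A1 G sigma factor Gresp sigmaP T0 *.
    exists 0%N, (fun=> 0), (fun=> 0); split=> [[]//|X|rho /T0//].
    by rewrite big_ord0 /mxtrace big_ord0.
  exists 1%N, (fun=> 1%:M), (fun=> delta_mx ord0 ord0); split=> [_|X|rho /T0//].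
    rewrite /mxtrace (bigD1 ord0)//= mxE eqxx big1 ?addr0// => a /negPf a0.
    by rewrite mxE a0.
  by rewrite big_ord1 mulmx1.
pose G' l := G l + (if l == ord0 then 1%:M - \sum_l' G l' else 0).
(* On [T] the correction pairs to 1 - 1 = 0, so the responses are unchanged. *)
have G'E rho l : T rho -> \tr (rho *m G' l) = \tr (rho *m G l).
  move=> Trho; rewrite mulmxDr mxtraceD; case: ifP => _; last by rewrite mulmx0 mxtrace0 addr0.
  have [_ G1] := Gresp _ Trho; have [_ rho1] := Tst _ Trho.
  have trG1 : \tr (rho *m \sum_l' G l') = 1 by rewrite mulmx_sumr raddf_sum.
  by rewrite mulmxBr mulmx1 raddfB /= trG1 rho1 subrr addr0.
exists k.+1, G', sigma; split=> [l|X|rho Trho]; first by case: (sigmaP l).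
  rewrite -(raddf_sum (@mxtrace R[i] d)) -mulmx_sumr /G' big_split /= -big_mkcond /=.
  by rewrite big_pred1_eq addrC subrK mulmx1.
split=> [l|l E AE|E AE].
- by rewrite G'E//; case: (Gresp _ Trho).
- by case: (sigmaP l) => _; apply.
- by rewrite factor//; apply: eq_bigr => l _; rewrite G'E.
Qed.

Theorem theorem3 (R : realType) (d : nat) (T A : 'M[R[i]]_d -> Prop) :
  (forall rho, T rho -> is_state rho) -> convex_set T ->
  (forall E, A E -> is_effect E) -> convex_set A ->
  A 1%:M -> (forall E, A E -> A (1%:M - E)) ->
  (MP_noncontextual T A <-> forall n : nat, pseudo_broadcastable T A n).
Proof.
move=> Tst _ Aeff _ A1 AC; split=> [nc n|pb].
  exact: noncontextual_broadcastable.
exact: broadcastable_noncontextual.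
Qed.
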